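(* Let $G\dashv R$ be a monoidal adjunction between monoidal categories, with left adjoint $G\colon\mathcal{C}\to\mathcal{D}$ and right adjoint $R\colon\mathcal{D}\to\mathcal{C}$, such that the projection formula holds for $R$. Then $R$ induces a braided lax monoidal functor $$\mathcal{Z}(R)\colon\mathcal{Z}(\mathcal{D})\to\mathcal{Z}(\mathcal{C}),\qquad (X,c)\mapsto(RX,c^R),$$ where for every object $A$ of $\mathcal{C}$ the half-braiding $c^R$ is $$c^R_A=\Big(RX\otimes A\xrightarrow{\mathrm{rproj}_{X,A}}R(X\otimes GA)\xrightarrow{R(c_{GA})}R(GA\otimes X)\xrightarrow{(\mathrm{lproj}_{A,X})^{-1}}A\otimes RX\Big).$$ The lax monoidal structure of $\mathcal{Z}(R)$ is inherited from that of $R$, i.e. $\mathrm{lax}^{\mathcal{Z}(R)}_{(X,c),(Y,d)}=\mathrm{lax}^R_{X,Y}$ and $\mathrm{lax}^{\mathcal{Z}(R)}_0=\mathrm{lax}^R_0$.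
   Context: Conventions: monoidal categories are written as if strict. A lax monoidal functor $F$ has structure maps $\mathrm{lax}^F_{X,Y}\colon FX\otimes FY\to F(X\otimes Y)$ (natural) and $\mathrm{lax}^F_0\colon\mathbb{1}\to F\mathbb{1}$ satisfying associativity and unitality. A lax monoidal functor $F$ between braided monoidal categories (braidings $\Psi$) is braided if $\mathrm{lax}_{Y,X}\circ\Psi_{FX,FY}=F(\Psi_{X,Y})\circ\mathrm{lax}_{X,Y}$. A monoidal adjunction $G\dashv R$ is an adjunction in which $G,R$ are lax monoidal and the unit and counit are monoidal transformations (then $G$ is automatically strong monoidal). Projection formula morphisms, for $A\in\mathcal{C}$, $X\in\mathcal{D}$: $\mathrm{lproj}_{A,X}=\mathrm{lax}^R_{GA,X}\circ(\mathrm{unit}_A\otimes RX)\colon A\otimes RX\to R(GA\otimes X)$ and $\mathrm{rproj}_{X,A}=\mathrm{lax}^R_{X,GA}\circ(RX\otimes\mathrm{unit}_A)\colon RX\otimes A\to R(X\otimes GA)$. The projection formula holds for $R$ if $\mathrm{lproj}_{A,X}$ and $\mathrm{rproj}_{X,A}$ are isomorphisms for all $A,X$. The Drinfeld center $\mathcal{Z}(\mathcal{C})$ has objects $(X,c)$ with $c=(c_A\colon X\otimes A\xrightarrow{\sim}A\otimes X)_{A\in\mathcal{C}}$ a natural isomorphism with $c_{A\otimes B}=(A\otimes c_B)(c_A\otimes B)$ and $c_{\mathbb{1}}=\mathrm{id}$; morphisms are morphisms of $\mathcal{C}$ commuting with half-braidings; $(X,c)\otimes(Y,d)=(X\otimes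 Y,(c_A\otimes Y)(X\otimes d_A))$; the braiding is $\Psi_{(X,c),(Y,d)}=c_Y$. The functor $\mathcal{Z}(R)$ acts as $R$ on morphisms. *)

(* Defs.v *)
(* Stdlib only.  Proof irrelevance is used so that morphisms of the Drinfeld
   center are equal as soon as the underlying morphisms are.

   Monoidal categories are not assumed strict: each formula that is usually
   written as if the tensor product were strictly associative and unital
   carries explicit associators α and unitors λ, ρ. *)
From Stdlib Require Import ProofIrrelevance.

Set Implicit Arguments.
Unset Strict Implicit.
Set Maximal Implicit Insertion.

Record category := Category {
  ob :> Type;
  hom : ob -> ob -> Type;
  idm : forall X, hom X X;
  comp : forall X Y Z, hom Y Z -> hom X Y -> hom X Z;
  comp_id_l : forall X Y (f : hom X Y), comp (idm Y) f = f;
  comp_id_r : forall X Y (f : hom X Y), comp f (idm X) = f;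
  comp_assoc : forall X Y Z W (h : hom Z W) (g : hom Y Z) (f : hom X Y),
    comp (comp h g) f = comp h (comp g f)
}.
Arguments hom {c} X Y : rename.
Arguments idm {c} X : rename.

Declare Scope cat_scope.
Delimit Scope cat_scope with cat.
Open Scope cat_scope.

Notation "X ~> Y" := (hom X Y) (at level 90, Y at level 89, no associativity)
  : cat_scope.
Notation "g ∘ f" := (comp g f) (at level 38, right associativity) : cat_scope.

(* Being an isomorphism is recorded with the inverse as data; the inverse is
   unique, so this is the usual property, with the inverse made available. *)
Record is_iso (C : category) (X Y : C) (f : X ~> Y) := IsIso {
  inv_of : Y ~> X;
  inv_of_r : f ∘ inv_of = idm Y;
  inv_of_l : inv_of ∘ f = idm X
}.

Record iso (C : category) (X Y : C) := Iso {
  fwd :> X ~> Y;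
  fwd_is_iso : is_iso fwd
}.

Definition inverse (C : category) (X Y : C) (f : iso X Y) : Y ~> X :=
  inv_of (fwd_is_iso f).
Notation "f ⁻¹" := (inverse f) (at level 3, format "f ⁻¹") : cat_scope.

Lemma iso_r (C : category) (X Y : C) (f : iso X Y) : f ∘ f⁻¹ = idm Y.
Proof. exact (inv_of_r (fwd_is_iso f)). Qed.
Lemma iso_l (C : category) (X Y : C) (f : iso X Y) : f⁻¹ ∘ f = idm X.
Proof. exact (inv_of_l (fwd_is_iso f)). Qed.

Definition iso_inv (C : category) (X Y : C) (f : iso X Y) : iso Y X :=
  Iso (IsIso (iso_l f) (iso_r f)).

Lemma iso_comp_r (C : category) (X Y Z : C) (g : iso Y Z) (f : iso X Y) :
  (g ∘ f) ∘ (f⁻¹ ∘ g⁻¹) = idm Z.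
Proof.
  rewrite comp_assoc, <- (comp_assoc (fwd f)), iso_r, comp_id_l. apply iso_r.
Qed.
Lemma iso_comp_l (C : category) (X Y Z : C) (g : iso Y Z) (f : iso X Y) :
  (f⁻¹ ∘ g⁻¹) ∘ (g ∘ f) = idm X.
Proof.
  rewrite comp_assoc, <- (comp_assoc (inverse g)), iso_l, comp_id_l. apply iso_l.
Qed.

Definition iso_comp (C : category) (X Y Z : C) (g : iso Y Z) (f : iso X Y)
  : iso X Z := Iso (IsIso (iso_comp_r g f) (iso_comp_l g f)).

Record functor_data (C D : category) := FunctorData {
  fob :> C -> D;
  fmap : forall X Y : C, (X ~> Y) -> (fob X ~> fob Y)
}.
Arguments fmap {C D} f0 {X Y} f : rename.

Record is_functor (C D : category) (F : functor_data C D) : Prop := IsFunctor {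
  fmap_id : forall X : C, fmap F (idm X) = idm (F X);
  fmap_comp : forall (X Y Z : C) (g : Y ~> Z) (f : X ~> Y),
    fmap F (g ∘ f) = fmap F g ∘ fmap F f
}.

Definition is_natural (C D : category) (F F' : functor_data C D)
    (t : forall X : C, F X ~> F' X) : Prop :=
  forall (X Y : C) (f : X ~> Y), t Y ∘ fmap F f = fmap F' f ∘ t X.

Record monoidal_category := MonoidalCategory {
  mcat :> category;
  munit : mcat;
  tens : mcat -> mcat -> mcat;
  tensm : forall X X' Y Y' : mcat,
    (X ~> X') -> (Y ~> Y') -> (tens X Y ~> tens X' Y');
  assoc : forall X Y Z : mcat, iso (tens (tens X Y) Z) (tens X (tens Y Z));
  lunit : forall X : mcat, iso (tens munit X) X;
  runit : forall X : mcat, iso (tens X munit) X;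
  tensm_id : forall X Y : mcat, tensm (idm X) (idm Y) = idm (tens X Y);
  tensm_comp : forall (X X' X'' Y Y' Y'' : mcat)
      (f' : X' ~> X'') (f : X ~> X') (g' : Y' ~> Y'') (g : Y ~> Y'),
    tensm (f' ∘ f) (g' ∘ g) = tensm f' g' ∘ tensm f g;
  assoc_nat : forall (X X' Y Y' Z Z' : mcat)
      (f : X ~> X') (g : Y ~> Y') (h : Z ~> Z'),
    assoc X' Y' Z' ∘ tensm (tensm f g) h = tensm f (tensm g h) ∘ assoc X Y Z;
  lunit_nat : forall (X X' : mcat) (f : X ~> X'),
    lunit X' ∘ tensm (idm munit) f = f ∘ lunit X;
  runit_nat : forall (X X' : mcat) (f : X ~> X'),
    runit X' ∘ tensm f (idm munit) = f ∘ runit X;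
  pentagon : forall X Y Z W : mcat,
    assoc X Y (tens Z W) ∘ assoc (tens X Y) Z W
    = tensm (idm X) (assoc Y Z W) ∘ assoc X (tens Y Z) W
      ∘ tensm (assoc X Y Z) (idm W);
  triangle : forall X Y : mcat,
    tensm (idm X) (lunit Y) ∘ assoc X munit Y = tensm (runit X) (idm Y)
}.
Arguments munit {m} : rename.
Arguments tens {m} X Y : rename.
Arguments assoc {m} X Y Z : rename.
Arguments lunit {m} X : rename.
Arguments runit {m} X : rename.

Notation "X ⊗ Y" := (tens X Y) (at level 32, right associativity) : cat_scope.
Notation "f ⊠ g" := (tensm f g) (at level 34, no associativity) : cat_scope.
Notation "X ◁ f" := (tensm (idm X) f) (at level 34, no associativity) : cat_scope.
Notation "f ▷ X" := (tensm f (idm X)) (at level 34, no associativity) : cat_scope.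
Notation "𝟙" := munit : cat_scope.
Notation α := assoc.
Notation λ := lunit.
Notation ρ := runit.

Record braided_category := BraidedCategory {
  bmon :> monoidal_category;
  braid : forall X Y : bmon, iso (X ⊗ Y) (Y ⊗ X);
  braid_nat : forall (X X' Y Y' : bmon) (f : X ~> X') (g : Y ~> Y'),
    braid X' Y' ∘ (f ⊠ g) = (g ⊠ f) ∘ braid X Y;
  hexagon_l : forall X Y Z : bmon,
    α Y Z X ∘ braid X (Y ⊗ Z) ∘ α X Y Z
    = (Y ◁ braid X Z) ∘ α Y X Z ∘ (braid X Y ▷ Z);
  hexagon_r : forall X Y Z : bmon,
    (α Z X Y)⁻¹ ∘ braid (X ⊗ Y) Z ∘ (α X Y Z)⁻¹
    = (braid X Z ▷ Y) ∘ (α X Z Y)⁻¹ ∘ (X ◁ braid Y Z)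
}.
Arguments braid {b} X Y : rename.

Record lax_functor_data (C D : monoidal_category) := LaxFunctorData {
  lax_fun :> functor_data C D;
  lax : forall X Y : C, lax_fun X ⊗ lax_fun Y ~> lax_fun (X ⊗ Y);
  lax0 : 𝟙 ~> lax_fun 𝟙
}.
Arguments lax {C D} F X Y : rename.
Arguments lax0 {C D} F : rename.

Record is_lax_functor (C D : monoidal_category) (F : lax_functor_data C D)
    : Prop := IsLaxFunctor {
  lax_is_functor : is_functor F;
  lax_nat : forall (X X' Y Y' : C) (f : X ~> X') (g : Y ~> Y'),
    lax F X' Y' ∘ (fmap F f ⊠ fmap F g) = fmap F (f ⊠ g) ∘ lax F X Y;
  lax_assoc : forall X Y Z : C,
    fmap F (α X Y Z) ∘ lax F (X ⊗ Y) Z ∘ (lax F X Y ▷ F Z)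
    = lax F X (Y ⊗ Z) ∘ (F X ◁ lax F Y Z) ∘ α (F X) (F Y) (F Z);
  lax_lunit : forall X : C,
    fmap F (λ X) ∘ lax F 𝟙 X ∘ (lax0 F ▷ F X) = λ (F X);
  lax_runit : forall X : C,
    fmap F (ρ X) ∘ lax F X 𝟙 ∘ (F X ◁ lax0 F) = ρ (F X)
}.

Record lax_functor (C D : monoidal_category) := LaxFunctor {
  lax_data :> lax_functor_data C D;
  lax_laws : is_lax_functor lax_data
}.

Definition lax_id (C : monoidal_category) : lax_functor_data C C := {|
  lax_fun := {| fob := fun X => X; fmap := fun X Y f => f |};
  lax := fun X Y => idm (X ⊗ Y);
  lax0 := idm 𝟙
|}.

Definition lax_comp (C D E : monoidal_category)
    (F' : lax_functor_data D E) (F : lax_functor_data C D)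
  : lax_functor_data C E := {|
  lax_fun := {| fob := fun X => F' (F X);
                fmap := fun X Y f => fmap F' (fmap F f) |};
  lax := fun X Y => fmap F' (lax F X Y) ∘ lax F' (F X) (F Y);
  lax0 := fmap F' (lax0 F) ∘ lax0 F'
|}.

Record is_monoidal_trans (C D : monoidal_category) (F F' : lax_functor_data C D)
    (t : forall X : C, F X ~> F' X) : Prop := IsMonoidalTrans {
  mt_nat : is_natural t;
  mt_lax : forall X Y : C, t (X ⊗ Y) ∘ lax F X Y = lax F' X Y ∘ (t X ⊠ t Y);
  mt_lax0 : t 𝟙 ∘ lax0 F = lax0 F'
}.

Definition is_braided (C D : braided_category) (F : lax_functor_data C D) : Prop :=
  forall X Y : C, lax F Y X ∘ braid (F X) (F Y) = fmap F (braid X Y) ∘ lax F X Y.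

Record monoidal_adjunction (C D : monoidal_category)
    (G : lax_functor C D) (R : lax_functor D C) := MonoidalAdjunction {
  adj_unit : forall A : C, A ~> R (G A);
  adj_counit : forall X : D, G (R X) ~> X;
  adj_triangle_l : forall A : C,
    adj_counit (G A) ∘ fmap G (adj_unit A) = idm (G A);
  adj_triangle_r : forall X : D,
    fmap R (adj_counit X) ∘ adj_unit (R X) = idm (R X);
  adj_unit_monoidal :
    @is_monoidal_trans C C (lax_id C) (lax_comp R G) adj_unit;
  adj_counit_monoidal :
    @is_monoidal_trans D D (lax_comp G R) (lax_id D) adj_counit
}.

Section Projection.
Variables (C D : monoidal_category) (G : lax_functor C D) (R : lax_functor D C).
Variable adj : monoidal_adjunction G R.

Definition lproj (A : C) (X : D) : A ⊗ R X ~> R (G A ⊗ X) :=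
  lax R (G A) X ∘ (adj_unit adj A ▷ R X).

Definition rproj (X : D) (A : C) : R X ⊗ A ~> R (X ⊗ G A) :=
  lax R X (G A) ∘ (R X ◁ adj_unit adj A).

Record projection_formula := ProjectionFormula {
  lproj_is_iso : forall (A : C) (X : D), is_iso (lproj A X);
  rproj_is_iso : forall (X : D) (A : C), is_iso (rproj X A)
}.
End Projection.

Lemma fmap_iso_r (C D : category) (F : functor_data C D) (FF : is_functor F)
    (X Y : C) (f : iso X Y) : fmap F f ∘ fmap F f⁻¹ = idm (F Y).
Proof. rewrite <- fmap_comp, iso_r by exact FF. apply fmap_id, FF. Qed.
Lemma fmap_iso_l (C D : category) (F : functor_data C D) (FF : is_functor F)
    (X Y : C) (f : iso X Y) : fmap F f⁻¹ ∘ fmap F f = idm (F X).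
Proof. rewrite <- fmap_comp, iso_l by exact FF. apply fmap_id, FF. Qed.

Definition fmap_iso (C D : category) (F : functor_data C D) (FF : is_functor F)
    (X Y : C) (f : iso X Y) : iso (F X) (F Y) :=
  Iso (IsIso (fmap_iso_r FF f) (fmap_iso_l FF f)).

Section Reassociate.
Variable C : category.
Lemma rw1 (X Y W : C) (a b : X ~> Y) (z : W ~> X) : a = b -> a ∘ z = b ∘ z.
Proof. intros ->. reflexivity. Qed.
Lemma rw2 (X Y Z W : C) (a : Y ~> Z) (b : X ~> Y) r (z : W ~> X) :
  a ∘ b = r -> a ∘ b ∘ z = r ∘ z.
Proof. intros <-. symmetry. apply comp_assoc. Qed.
Lemma rw3 (X Y Z T W : C) (c : Z ~> T) (a : Y ~> Z) (b : X ~> Y) r (z : W ~> X) :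
  c ∘ a ∘ b = r -> c ∘ a ∘ b ∘ z = r ∘ z.
Proof. intros <-. rewrite !comp_assoc. reflexivity. Qed.
Lemma iso_lz (X Y W : C) (f : iso X Y) (z : W ~> X) : f⁻¹ ∘ f ∘ z = z.
Proof. rewrite (rw2 _ (iso_l f)). apply comp_id_l. Qed.
Lemma iso_rz (X Y W : C) (f : iso X Y) (z : W ~> Y) : f ∘ f⁻¹ ∘ z = z.
Proof. rewrite (rw2 _ (iso_r f)). apply comp_id_l. Qed.
Lemma iso_monic (X Y W : C) (f : iso X Y) (a b : W ~> X) : f ∘ a = f ∘ b -> a = b.
Proof. intros H. rewrite <- (iso_lz f a), H. apply iso_lz. Qed.
Lemma iso_epic (X Y W : C) (f : iso X Y) (a b : Y ~> W) : a ∘ f = b ∘ f -> a = b.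
Proof.
  intros H. rewrite <- (comp_id_r a), <- (iso_r f), <- comp_assoc, H.
  rewrite comp_assoc, iso_r. apply comp_id_r.
Qed.
End Reassociate.
Arguments iso_monic {C X Y W} f {a b} _.
Arguments iso_epic {C X Y W} f {a b} _.

Ltac nf := rewrite ?comp_assoc, ?comp_id_l, ?comp_id_r.
Ltac can := repeat (nf; rewrite ?iso_l, ?iso_r, ?iso_lz, ?iso_rz); nf.
Tactic Notation "rw" uconstr(E) :=
  first [ rewrite (rw3 _ E) | rewrite (rw2 _ E) | rewrite E ]; nf.
Tactic Notation "rwl" uconstr(E) :=
  first [ rewrite (rw3 _ (eq_sym E)) | rewrite (rw2 _ (eq_sym E))
        | rewrite (eq_sym E) ]; nf.

Section MonoidalLemmas.
Variable C : monoidal_category.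
Implicit Types X Y Z W A B : C.

Lemma lw_comp X Y Z W (g : Z ~> W) (f : Y ~> Z) : (X ◁ g) ∘ (X ◁ f) = X ◁ (g ∘ f).
Proof. rewrite <- tensm_comp, comp_id_l. reflexivity. Qed.
Lemma rw_comp X Y Z W (g : Z ~> W) (f : Y ~> Z) : (g ▷ X) ∘ (f ▷ X) = (g ∘ f) ▷ X.
Proof. rewrite <- tensm_comp, comp_id_l. reflexivity. Qed.

Lemma interchange X X' Y Y' (f : X ~> X') (g : Y ~> Y') :
  (f ▷ Y') ∘ (X ◁ g) = (X' ◁ g) ∘ (f ▷ Y).
Proof. rewrite <- !tensm_comp, !comp_id_l, !comp_id_r. reflexivity. Qed.
Lemma tensm_lr X X' Y Y' (f : X ~> X') (g : Y ~> Y') :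
  f ⊠ g = (f ▷ Y') ∘ (X ◁ g).
Proof. rewrite <- !tensm_comp, !comp_id_l, !comp_id_r. reflexivity. Qed.

Lemma tens_iso_r X X' Y Y' (f : iso X X') (g : iso Y Y') :
  (f ⊠ g) ∘ (f⁻¹ ⊠ g⁻¹) = idm (X' ⊗ Y').
Proof. rewrite <- tensm_comp, !iso_r. apply tensm_id. Qed.
Lemma tens_iso_l X X' Y Y' (f : iso X X') (g : iso Y Y') :
  (f⁻¹ ⊠ g⁻¹) ∘ (f ⊠ g) = idm (X ⊗ Y).
Proof. rewrite <- tensm_comp, !iso_l. apply tensm_id. Qed.
Definition tens_iso X X' Y Y' (f : iso X X') (g : iso Y Y')
  : iso (X ⊗ Y) (X' ⊗ Y') := Iso (IsIso (tens_iso_r f g) (tens_iso_l f g)).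

Lemma id_iso_eq X : idm X ∘ idm X = idm X.
Proof. apply comp_id_l. Qed.
Definition id_iso X : iso X X := Iso (IsIso (id_iso_eq X) (id_iso_eq X)).
Definition lw_iso X Y Z (f : iso Y Z) : iso (X ⊗ Y) (X ⊗ Z) := tens_iso (id_iso X) f.
Definition rw_iso X Y Z (f : iso Y Z) : iso (Y ⊗ X) (Z ⊗ X) := tens_iso f (id_iso X).

Lemma lw_lz X Y Z W (f : iso Y Z) (z : W ~> X ⊗ Y) : (X ◁ f⁻¹) ∘ (X ◁ f) ∘ z = z.
Proof. exact (iso_lz (lw_iso X f) z). Qed.
Lemma lw_rz X Y Z W (f : iso Y Z) (z : W ~> X ⊗ Z) : (X ◁ f) ∘ (X ◁ f⁻¹) ∘ z = z.
Proof. exact (iso_rz (lw_iso X f) z). Qed.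
Lemma rw_lz X Y Z W (f : iso Y Z) (z : W ~> Y ⊗ X) : (f⁻¹ ▷ X) ∘ (f ▷ X) ∘ z = z.
Proof. exact (iso_lz (rw_iso X f) z). Qed.
Lemma rw_rz X Y Z W (f : iso Y Z) (z : W ~> Z ⊗ X) : (f ▷ X) ∘ (f⁻¹ ▷ X) ∘ z = z.
Proof. exact (iso_rz (rw_iso X f) z). Qed.

Lemma nat_l X X' Y Z (f : X ~> X') :
  α X' Y Z ∘ ((f ▷ Y) ▷ Z) = (f ▷ (Y ⊗ Z)) ∘ α X Y Z.
Proof. rewrite assoc_nat, tensm_id. reflexivity. Qed.
Lemma nat_m X Y Y' Z (f : Y ~> Y') :
  α X Y' Z ∘ ((X ◁ f) ▷ Z) = (X ◁ (f ▷ Z)) ∘ α X Y Z.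
Proof. apply assoc_nat. Qed.
Lemma nat_r X Y Z Z' (f : Z ~> Z') :
  α X Y Z' ∘ ((X ⊗ Y) ◁ f) = (X ◁ (Y ◁ f)) ∘ α X Y Z.
Proof. rewrite <- tensm_id, assoc_nat. reflexivity. Qed.

#[global] Arguments nat_l {X X' Y Z} f.
#[global] Arguments nat_m {X Y Y' Z} f.
#[global] Arguments nat_r {X Y Z Z'} f.

Lemma flip X X' Y Y' (i : iso X X') (j : iso Y Y') (f : X ~> Y) (f' : X' ~> Y') :
  j ∘ f = f' ∘ i -> f ∘ i⁻¹ = j⁻¹ ∘ f'.
Proof.
  intros H. apply (iso_monic j). rewrite iso_rz, <- comp_assoc, H. can. reflexivity.
Qed.

Lemma inv_nat_l X X' Y Z (f : X ~> X') :
  ((f ▷ Y) ▷ Z) ∘ (α X Y Z)⁻¹ = (α X' Y Z)⁻¹ ∘ (f ▷ (Y ⊗ Z)).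
Proof. apply flip, nat_l. Qed.
Lemma inv_nat_m X Y Y' Z (f : Y ~> Y') :
  ((X ◁ f) ▷ Z) ∘ (α X Y Z)⁻¹ = (α X Y' Z)⁻¹ ∘ (X ◁ (f ▷ Z)).
Proof. apply flip, nat_m. Qed.
Lemma inv_nat_r X Y Z Z' (f : Z ~> Z') :
  ((X ⊗ Y) ◁ f) ∘ (α X Y Z)⁻¹ = (α X Y Z')⁻¹ ∘ (X ◁ (Y ◁ f)).
Proof. apply flip, nat_r. Qed.

#[global] Arguments inv_nat_l {X X' Y Z} f.
#[global] Arguments inv_nat_m {X Y Y' Z} f.
#[global] Arguments inv_nat_r {X Y Z Z'} f.

Lemma pent2 X Y Z W :
  (α X Y (Z ⊗ W))⁻¹ ∘ (X ◁ α Y Z W) ∘ α X (Y ⊗ Z) W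
  = α (X ⊗ Y) Z W ∘ ((α X Y Z)⁻¹ ▷ W).
Proof.
  apply (iso_monic (α X Y (Z ⊗ W))). can. rw (pentagon X Y Z W).
  rewrite rw_comp, iso_r, tensm_id. nf. reflexivity.
Qed.
Lemma pent3 X Y Z W :
  ((α X Y Z)⁻¹ ▷ W) ∘ (α X (Y ⊗ Z) W)⁻¹ ∘ (X ◁ (α Y Z W)⁻¹)
  = (α (X ⊗ Y) Z W)⁻¹ ∘ (α X Y (Z ⊗ W))⁻¹.
Proof.
  apply (iso_epic (iso_comp (α X Y (Z ⊗ W)) (α (X ⊗ Y) Z W))). cbn. can.
  rewrite pentagon, lw_lz. can. exact (iso_l (rw_iso W (α X Y Z))).
Qed.
Lemma pent4 X Y Z W :
  α X (Y ⊗ Z) W ∘ (α X Y Z ▷ W) ∘ (α (X ⊗ Y) Z W)⁻¹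
  = (X ◁ (α Y Z W)⁻¹) ∘ α X Y (Z ⊗ W).
Proof.
  apply (iso_epic (α (X ⊗ Y) Z W)). can. rewrite pentagon, lw_lz. reflexivity.
Qed.

Lemma lw_faithful Y Z (f g : Y ~> Z) : 𝟙 ◁ f = 𝟙 ◁ g -> f = g.
Proof.
  intros H. apply (iso_epic (λ Y)). rewrite <- !lunit_nat, H. reflexivity.
Qed.
Lemma rw_faithful Y Z (f g : Y ~> Z) : f ▷ 𝟙 = g ▷ 𝟙 -> f = g.
Proof.
  intros H. apply (iso_epic (ρ Y)). rewrite <- !runit_nat, H. reflexivity.
Qed.

Lemma lunit_tens X Y : λ (X ⊗ Y) ∘ α 𝟙 X Y = λ X ▷ Y.
Proof.
  apply lw_faithful. rewrite <- lw_comp.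
  apply (iso_epic (iso_comp (α 𝟙 (𝟙 ⊗ X) Y) (rw_iso Y (α 𝟙 𝟙 X)))). cbn. nf.
  rewrite <- pentagon. rw (triangle 𝟙 (X ⊗ Y)). rwl (nat_l _). rwl (nat_m _).
  rewrite rw_comp, triangle. reflexivity.
Qed.
Lemma runit_tens X Y : (X ◁ ρ Y) ∘ α X Y 𝟙 = ρ (X ⊗ Y).
Proof.
  apply rw_faithful. rewrite <- rw_comp. apply (iso_monic (α X Y 𝟙)).
  rw (nat_m _). rewrite <- triangle, <- lw_comp. nf. rewrite <- pentagon.
  rwl (nat_r _). rewrite triangle. reflexivity.
Qed.
Lemma lunit_runit : fwd (λ (𝟙 : C)) = ρ 𝟙.
Proof.
  assert (H : fwd (λ (𝟙 ⊗ 𝟙 : C)) = 𝟙 ◁ λ 𝟙).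
  { apply (iso_monic (λ 𝟙)). symmetry. apply lunit_nat. }
  apply rw_faithful. rewrite <- lunit_tens, H. apply triangle.
Qed.
Lemma runit_inv_tens X Y : α X Y 𝟙 ∘ (ρ (X ⊗ Y))⁻¹ = X ◁ (ρ Y)⁻¹.
Proof.
  apply (iso_monic (lw_iso X (ρ Y))). cbn. rw (runit_tens X Y). can.
  symmetry. exact (iso_r (lw_iso X (ρ Y))).
Qed.
Lemma lunit_tens_inv X Y : (λ X ▷ Y) ∘ (α 𝟙 X Y)⁻¹ = λ (X ⊗ Y).
Proof. rewrite <- lunit_tens. can. reflexivity. Qed.
Lemma runit_tens_inv X Y : ρ (X ⊗ Y) ∘ (α X Y 𝟙)⁻¹ = X ◁ ρ Y.
Proof. rewrite <- runit_tens. can. reflexivity. Qed.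
Lemma triangle_inv X Y : (ρ X ▷ Y) ∘ (α X 𝟙 Y)⁻¹ = X ◁ λ Y.
Proof. rewrite <- triangle. can. reflexivity. Qed.
End MonoidalLemmas.

(* hb_tens is c_{A⊗B} = (A ⊗ c_B)(c_A ⊗ B) and hb_unit is c_𝟙 = id, up to
   associators and unitors. *)
Record is_half_braiding (C : monoidal_category) (X : C)
    (c : forall A : C, iso (X ⊗ A) (A ⊗ X)) : Prop := IsHalfBraiding {
  hb_nat : forall (A B : C) (f : A ~> B), c B ∘ (X ◁ f) = (f ▷ X) ∘ c A;
  hb_tens : forall A B : C,
    α A B X ∘ c (A ⊗ B) ∘ α X A B = (A ◁ c B) ∘ α A X B ∘ (c A ▷ B);
  hb_unit : λ X ∘ c 𝟙 = ρ X
}.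

Record center_ob (C : monoidal_category) := CenterOb {
  cob : C;
  hbr : forall A : C, iso (cob ⊗ A) (A ⊗ cob);
  hbr_laws : is_half_braiding hbr
}.

Definition is_central (C : monoidal_category) (X Y : center_ob C)
    (f : cob X ~> cob Y) : Prop :=
  forall A : C, (A ◁ f) ∘ hbr X A = hbr Y A ∘ (f ▷ A).

Record center_hom (C : monoidal_category) (X Y : center_ob C) := CenterHom {
  chom :> cob X ~> cob Y;
  chom_central : is_central chom
}.
Arguments CenterHom {C X Y} chom chom_central.

Section Center.
Variable C : monoidal_category.
Implicit Types X Y Z : center_ob C.

Lemma center_hom_eq X Y (f g : center_hom X Y) : chom f = chom g -> f = g.
Proof.
  destruct f as [f Hf], g as [g Hg]; cbn. intros ->. f_equal. apply proof_irrelevance.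
Qed.

Lemma central_id X : is_central (X := X) (Y := X) (idm (cob X)).
Proof. intros A. rewrite !tensm_id, comp_id_l, comp_id_r. reflexivity. Qed.

Lemma central_comp X Y Z (g : cob Y ~> cob Z) (f : cob X ~> cob Y) :
  is_central (X := Y) (Y := Z) g -> is_central f -> is_central (X := X) (Y := Z) (g ∘ f).
Proof.
  intros Hg Hf A. rewrite <- lw_comp, <- rw_comp. nf. rewrite Hf. rw (Hg A). reflexivity.
Qed.

Lemma central_inv X Y (f : iso (cob X) (cob Y)) :
  is_central (X := X) (Y := Y) f -> is_central (X := Y) (Y := X) f⁻¹.
Proof.
  intros Hf A. apply (iso_monic (lw_iso A f)). cbn. rewrite lw_rz. rw (Hf A).
  rewrite rw_comp, iso_r, tensm_id. can. reflexivity.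
Qed.

Program Definition center_category : category := {|
  ob := center_ob C;
  hom := @center_hom C;
  idm := fun X => CenterHom (idm (cob X)) (central_id X);
  comp := fun X Y Z g f =>
    CenterHom (g ∘ f) (central_comp (chom_central g) (chom_central f))
|}.
Next Obligation. intros. apply center_hom_eq. cbn. apply comp_id_l. Qed.
Next Obligation. intros. apply center_hom_eq. cbn. apply comp_id_r. Qed.
Next Obligation. intros. apply center_hom_eq. cbn. apply comp_assoc. Qed.

Program Definition center_iso X Y (f : iso (cob X) (cob Y))
    (Hf : is_central (X := X) (Y := Y) f) : @iso center_category X Y :=
  @Iso center_category X Y (CenterHom f Hf)
    (@IsIso center_category X Y _ (CenterHom f⁻¹ (central_inv Hf)) _ _).
Next Obligation. intros. apply center_hom_eq. cbn. apply iso_r. Qed.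
Next Obligation. intros. apply center_hom_eq. cbn. apply iso_l. Qed.

(* In a strict monoidal category: the identities. *)
Definition unit_hbr (A : C) : iso (𝟙 ⊗ A) (A ⊗ 𝟙) :=
  iso_comp (iso_inv (ρ A)) (λ A).

Lemma unit_hbrE A : fwd (unit_hbr A) = (ρ A)⁻¹ ∘ λ A.
Proof. reflexivity. Qed.

Lemma unit_hbr_laws : is_half_braiding unit_hbr.
Proof.
  split.
  - intros A B f. rewrite !unit_hbrE. nf. rw (lunit_nat f).
    apply (iso_monic (ρ B)). rewrite iso_rz. rw (runit_nat f). rewrite iso_rz. reflexivity.
  - intros A B. rewrite !unit_hbrE. nf.
    rewrite (rw2 _ (runit_inv_tens A B)), lunit_tens.
    rewrite <- lw_comp, <- rw_comp. nf. rw (triangle A B).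
    rewrite rw_rz. reflexivity.
  - rewrite unit_hbrE, lunit_runit, iso_rz. reflexivity.
Qed.

Definition center_unit : center_ob C := CenterOb unit_hbr_laws.

(* In a strict monoidal category: (c_A ⊗ Y)(X ⊗ d_A). *)
Definition tens_hbr (X Y : C) (c : forall A, iso (X ⊗ A) (A ⊗ X))
    (d : forall A, iso (Y ⊗ A) (A ⊗ Y)) (A : C) : iso ((X ⊗ Y) ⊗ A) (A ⊗ X ⊗ Y) :=
  iso_comp (α A X Y)
    (iso_comp (rw_iso Y (c A))
      (iso_comp (iso_inv (α X A Y))
        (iso_comp (lw_iso X (d A)) (α X Y A)))).

Lemma tens_hbrE (X Y : C) (c : forall A, iso (X ⊗ A) (A ⊗ X))
    (d : forall A, iso (Y ⊗ A) (A ⊗ Y)) (A : C) : fwd (tens_hbr c d A)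
  = α A X Y ∘ (c A ▷ Y) ∘ (α X A Y)⁻¹ ∘ (X ◁ d A) ∘ α X Y A.
Proof. reflexivity. Qed.

Lemma hb_nat' X A B (f : A ~> B) :
  hbr X B ∘ (cob X ◁ f) = (f ▷ cob X) ∘ hbr X A.
Proof. apply hb_nat, hbr_laws. Qed.
Lemma hb_tens' X A B :
  α A B (cob X) ∘ hbr X (A ⊗ B) ∘ α (cob X) A B
  = (A ◁ hbr X B) ∘ α A (cob X) B ∘ (hbr X A ▷ B).
Proof. apply hb_tens, hbr_laws. Qed.
Lemma hb_unit' X : λ (cob X) ∘ hbr X 𝟙 = ρ (cob X).
Proof. apply hb_unit, hbr_laws. Qed.

Lemma hb_tens_l X A B :
  α A B (cob X) ∘ hbr X (A ⊗ B)
  = (A ◁ hbr X B) ∘ α A (cob X) B ∘ (hbr X A ▷ B) ∘ (α (cob X) A B)⁻¹.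
Proof. rwl (hb_tens' X A B). can. reflexivity. Qed.
Lemma hb_tens_r X A B :
  hbr X (A ⊗ B) ∘ α (cob X) A B
  = (α A B (cob X))⁻¹ ∘ (A ◁ hbr X B) ∘ α A (cob X) B ∘ (hbr X A ▷ B).
Proof. rewrite <- (hb_tens' X A B). can. reflexivity. Qed.

Lemma tens_hbr_laws X Y : is_half_braiding (tens_hbr (hbr X) (hbr Y)).
Proof.
  split.
  - intros A B f. rewrite !tens_hbrE. nf. rw (nat_r f).
    rw (lw_comp _ _ _). rewrite hb_nat', <- lw_comp. nf.
    rwl (inv_nat_m _). rw (rw_comp _ _ _). rewrite hb_nat', <- rw_comp. nf.
    rw (nat_l _). reflexivity.
  - intros A B. rewrite !tens_hbrE. rewrite <- lw_comp, <- rw_comp. nf.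
    rewrite pentagon.
    rw (lw_comp _ (hbr Y (A ⊗ B)) _). rewrite hb_tens_r, <- !lw_comp. nf.
    rwl (nat_m _).
    rw (pentagon A B (cob X) (cob Y)).
    rw (rw_comp _ _ (hbr X (A ⊗ B))). rewrite hb_tens_l, <- !rw_comp. nf.
    rw (nat_m (hbr X B)).
    rw (pent3 (cob X) A B (cob Y)). rwl (inv_nat_r (hbr Y B)).
    rw (pent2 (cob X) A (cob Y) B).
    rw (inv_nat_l (hbr X A)). rw (pent4 A (cob X) B (cob Y)).
    rwl (pentagon A (cob X) (cob Y) B). rw (nat_l (hbr X A)).
    rwl (nat_r (hbr Y B)). rwl (interchange (hbr X A) (hbr Y B)).
    reflexivity.
  - rewrite tens_hbrE. rw (lunit_tens (cob X) (cob Y)).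
    rw (rw_comp _ _ (hbr X 𝟙)). rewrite hb_unit'.
    rw (triangle_inv (cob X) (cob Y)). rw (lw_comp _ _ (hbr Y 𝟙)).
    rewrite hb_unit'. apply runit_tens.
Qed.

Definition center_tens X Y : center_ob C := CenterOb (tens_hbr_laws X Y).

Lemma central_tensm X X' Y Y' (f : cob X ~> cob X') (g : cob Y ~> cob Y') :
  is_central (X := X) (Y := X') f -> is_central (X := Y) (Y := Y') g ->
  is_central (X := center_tens X Y) (Y := center_tens X' Y') (f ⊠ g).
Proof.
  intros Hf Hg. rewrite tensm_lr.
  apply (@central_comp (center_tens X Y) (center_tens X Y') (center_tens X' Y')).
  - clear Hg. intros A. cbn [hbr center_tens cob]. rewrite !tens_hbrE. nf.
    rwl (nat_m f). rw (rw_comp _ _ (hbr X A)). rewrite Hf, <- rw_comp. nf.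
    rw (inv_nat_l f). rw (interchange f (hbr Y' A)). rwl (nat_l f). reflexivity.
  - clear Hf. intros A. cbn [hbr center_tens cob]. rewrite !tens_hbrE. nf.
    rwl (nat_r g). rwl (interchange (hbr X A) g). rw (inv_nat_r g).
    rw (lw_comp _ _ (hbr Y A)). rewrite Hg, <- lw_comp. nf.
    rwl (nat_m g). reflexivity.
Qed.

Lemma central_assoc X Y Z :
  is_central (X := center_tens (center_tens X Y) Z)
             (Y := center_tens X (center_tens Y Z))
             (α (cob X) (cob Y) (cob Z)).
Proof.
  intros A. cbn [hbr center_tens cob]. rewrite !tens_hbrE. rewrite <- !rw_comp, <- !lw_comp. nf.
  rwl (pentagon A (cob X) (cob Y) (cob Z)). rw (nat_l (hbr X A)).
  rwl (pentagon (cob X) (cob Y) (cob Z) A). rwl (nat_r (hbr Z A)).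
  rwl (pent2 (cob X) A (cob Y) (cob Z)). rw (nat_m (hbr Y A)).
  rw (pent4 (cob X) (cob Y) A (cob Z)). reflexivity.
Qed.

Lemma central_lunit X :
  is_central (X := center_tens center_unit X) (Y := X) (λ (cob X)).
Proof.
  intros A. cbn [hbr center_tens center_unit cob]. rewrite tens_hbrE.
  cbn [hbr center_unit cob]. rewrite unit_hbrE, <- rw_comp. nf.
  rw (triangle A (cob X)). rewrite rw_rz. rw (lunit_tens_inv A (cob X)).
  rw (lunit_nat (hbr X A)). rewrite lunit_tens. reflexivity.
Qed.

Lemma central_runit X :
  is_central (X := center_tens X center_unit) (Y := X) (ρ (cob X)).
Proof.
  intros A. cbn [hbr center_tens center_unit cob]. rewrite tens_hbrE.
  cbn [hbr center_unit cob]. rewrite unit_hbrE, <- lw_comp. nf.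
  rw (runit_tens A (cob X)). rw (runit_nat (hbr X A)).
  rw (runit_tens_inv (cob X) A). rewrite lw_rz, triangle. reflexivity.
Qed.

Lemma central_hbr X Y :
  is_central (X := center_tens X Y) (Y := center_tens Y X) (hbr X (cob Y)).
Proof.
  intros A. cbn [hbr center_tens cob]. rewrite !tens_hbrE. nf.
  transitivity (α A (cob Y) (cob X) ∘ hbr X (A ⊗ cob Y) ∘ (cob X ◁ hbr Y A)
                ∘ α (cob X) (cob Y) A).
  - rw (hb_tens_l X A (cob Y)). reflexivity.
  - rw (hb_nat' X (hbr Y A)). rewrite hb_tens_r. reflexivity.
Qed.

Program Definition center_monoidal : monoidal_category := {|
  mcat := center_category;
  munit := center_unit;
  tens := center_tens;
  tensm := fun X X' Y Y' f g =>
    CenterHom (f ⊠ g) (central_tensm (chom_central f) (chom_central g));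
  assoc := fun X Y Z => center_iso (central_assoc X Y Z);
  lunit := fun X => center_iso (central_lunit X);
  runit := fun X => center_iso (central_runit X)
|}.
Next Obligation. intros. apply center_hom_eq, tensm_id. Qed.
Next Obligation. intros. apply center_hom_eq, tensm_comp. Qed.
Next Obligation. intros. apply center_hom_eq, assoc_nat. Qed.
Next Obligation. intros. apply center_hom_eq, lunit_nat. Qed.
Next Obligation. intros. apply center_hom_eq, runit_nat. Qed.
Next Obligation. intros. apply center_hom_eq, pentagon. Qed.
Next Obligation. intros. apply center_hom_eq, triangle. Qed.

Program Definition center : braided_category := {|
  bmon := center_monoidal;
  braid := fun X Y => center_iso (central_hbr X Y)
|}.
Next Obligation.
  intros X X' Y Y' f g. apply center_hom_eq. cbn.
  rewrite (tensm_lr (chom f) (chom g)), (tensm_lr (chom g) (chom f)). nf.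
  rewrite (interchange (chom f) (chom g)). rw (hb_nat' X' (chom g)).
  rewrite <- (chom_central f). reflexivity.
Qed.
Next Obligation. intros. apply center_hom_eq, hb_tens'. Qed.
Next Obligation.
  intros X Y Z. apply center_hom_eq.
  unfold inverse. cbn. can. reflexivity.
Qed.
End Center.

(* c^R_A = lproj_{A,X}⁻¹ ∘ R(c_{GA}) ∘ rproj_{X,A}, as an isomorphism. *)
Definition induced_hbr (C D : monoidal_category)
    (G : lax_functor C D) (R : lax_functor D C) (adj : monoidal_adjunction G R)
    (pf : projection_formula adj) (X : center_ob D) (A : C)
  : iso (R (cob X) ⊗ A) (A ⊗ R (cob X)) :=
  iso_comp (iso_inv (Iso (lproj_is_iso pf A (cob X))))
    (iso_comp (fmap_iso (lax_is_functor (lax_laws R)) (hbr X (G A)))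
              (Iso (rproj_is_iso pf (cob X) A))).

Lemma induced_hbrE (C D : monoidal_category)
    (G : lax_functor C D) (R : lax_functor D C) (adj : monoidal_adjunction G R)
    (pf : projection_formula adj) (X : center_ob D) (A : C) :
  fwd (induced_hbr pf X A)
  = inv_of (lproj_is_iso pf A (cob X)) ∘ fmap R (hbr X (G A)) ∘ rproj adj (cob X) A.
Proof. reflexivity. Qed.

(* Main.v *)
(* The induced half-braiding is characterised by
   lproj ∘ c^R_A = R(c_{GA}) ∘ rproj, and lproj is invertible, so each axiom
   may be checked after composing with lproj.  There the associativity and
   unitality of lax^R, together with the monoidality of the unit of the
   adjunction, reduce it to the image under R of the corresponding axiom for c.
   The functor is braided because the counit recovers lax^R from lproj and
   rproj. *)
Require Import Defs.

Set Implicit Arguments.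
Unset Strict Implicit.
Set Maximal Implicit Insertion.

(** * Rewriting rules for a lax monoidal functor *)

Section LaxFunctor.
Variables (C D : monoidal_category) (F : lax_functor C D).

Lemma lax_fmap_id (X : C) : fmap F (idm X) = idm (F X).
Proof. apply fmap_id, lax_laws. Qed.

Lemma lax_fmap_comp (X Y Z : C) (g : Y ~> Z) (f : X ~> Y) :
  fmap F g ∘ fmap F f = fmap F (g ∘ f).
Proof. symmetry. apply fmap_comp, lax_laws. Qed.

Lemma lax_fmap_compz (X Y Z : C) (W : D) (g : Y ~> Z) (f : X ~> Y) (z : W ~> F X) :
  fmap F g ∘ fmap F f ∘ z = fmap F (g ∘ f) ∘ z.
Proof. apply rw2, lax_fmap_comp. Qed.

Lemma lax_fmap_iso_lz (X Y : C) (W : D) (f : iso X Y) (z : W ~> F X) :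
  fmap F f⁻¹ ∘ fmap F f ∘ z = z.
Proof. exact (iso_lz (fmap_iso (lax_is_functor (lax_laws F)) f) z). Qed.

Lemma lax_natl (X X' Y : C) (f : X ~> X') :
  lax F X' Y ∘ (fmap F f ▷ F Y) = fmap F (f ▷ Y) ∘ lax F X Y.
Proof. rewrite <- lax_fmap_id. apply lax_nat, lax_laws. Qed.

Lemma lax_natr (X Y Y' : C) (f : Y ~> Y') :
  lax F X Y' ∘ (F X ◁ fmap F f) = fmap F (X ◁ f) ∘ lax F X Y.
Proof. rewrite <- lax_fmap_id. apply lax_nat, lax_laws. Qed.

(** This is [lax_assoc] solved for the inverse associator, which occurs in the half-braiding of a
    tensor product. *)
Lemma lax_assoc_inv (X Y Z : C) :
  lax F (X ⊗ Y) Z ∘ (lax F X Y ▷ F Z) ∘ (α (F X) (F Y) (F Z))⁻¹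
  = fmap F (α X Y Z)⁻¹ ∘ lax F X (Y ⊗ Z) ∘ (F X ◁ lax F Y Z).
Proof.
  apply (iso_monic (fmap_iso (lax_is_functor (lax_laws F)) (α X Y Z))).
  rewrite iso_rz. cbn. rw (lax_assoc (lax_laws F) X Y Z). can. reflexivity.
Qed.

Lemma lax_lunit_inv (X : C) :
  lax F 𝟙 X ∘ (lax0 F ▷ F X) = fmap F (λ X)⁻¹ ∘ λ (F X).
Proof.
  rewrite <- (lax_lunit (lax_laws F) X), lax_fmap_iso_lz. reflexivity.
Qed.

Lemma lax_runit_inv (X : C) :
  lax F X 𝟙 ∘ (F X ◁ lax0 F) = fmap F (ρ X)⁻¹ ∘ ρ (F X).
Proof.
  rewrite <- (lax_runit (lax_laws F) X), lax_fmap_iso_lz. reflexivity.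
Qed.
End LaxFunctor.

(** * Calculus of the projection morphisms *)

Section Projections.
Variables (C D : monoidal_category) (G : lax_functor C D) (R : lax_functor D C).
Variable adj : monoidal_adjunction G R.
Implicit Types (A B : C) (X Y : D).

Lemma unit_nat A B (f : A ~> B) :
  adj_unit adj B ∘ f = fmap R (fmap G f) ∘ adj_unit adj A.
Proof. exact (mt_nat (adj_unit_monoidal adj) f). Qed.

Lemma unit_tens A B :
  adj_unit adj (A ⊗ B)
  = fmap R (lax G A B) ∘ lax R (G A) (G B) ∘ (adj_unit adj A ⊠ adj_unit adj B).
Proof.
  (* The structure map of [lax_id] is an identity, so one is inserted to match [mt_lax]. *)
  rewrite <- (comp_id_r (adj_unit adj (A ⊗ B))).
  pose proof (mt_lax (adj_unit_monoidal adj) A B) as H. cbn in H.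
  rewrite H. nf. reflexivity.
Qed.

Lemma unit_unit : adj_unit adj 𝟙 = fmap R (lax0 G) ∘ lax0 R.
Proof.
  rewrite <- (comp_id_r (adj_unit adj 𝟙)).
  exact (mt_lax0 (adj_unit_monoidal adj)).
Qed.

Lemma lproj_natl A B X (f : A ~> B) :
  lproj adj B X ∘ (f ▷ R X) = fmap R (fmap G f ▷ X) ∘ lproj adj A X.
Proof.
  unfold lproj. nf. rw (rw_comp _ _ f). rewrite unit_nat, <- rw_comp.
  rw (lax_natl R _ _). reflexivity.
Qed.

Lemma lproj_natr A X Y (f : X ~> Y) :
  lproj adj A Y ∘ (A ◁ fmap R f) = fmap R (G A ◁ f) ∘ lproj adj A X.
Proof.
  unfold lproj. nf. rw (interchange _ (fmap R f)). rw (lax_natr R _ f).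
  reflexivity.
Qed.

Lemma rproj_natl X Y A (f : X ~> Y) :
  rproj adj Y A ∘ (fmap R f ▷ A) = fmap R (f ▷ G A) ∘ rproj adj X A.
Proof.
  unfold rproj. nf. rwl (interchange (fmap R f) _). rw (lax_natl R _ f).
  reflexivity.
Qed.

Lemma rproj_natr X A B (f : A ~> B) :
  rproj adj X B ∘ (R X ◁ f) = fmap R (X ◁ fmap G f) ∘ rproj adj X A.
Proof.
  unfold rproj. nf. rw (lw_comp _ _ f). rewrite unit_nat, <- lw_comp.
  rw (lax_natr R _ _). reflexivity.
Qed.

(** Both sides insert the unit at A and multiply three factors under R; associativity of [lax R]
    compares the two bracketings. *)
Lemma lproj_lax A X Y :
  lproj adj A (X ⊗ Y) ∘ (A ◁ lax R X Y) ∘ α A (R X) (R Y)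
  = fmap R (α (G A) X Y) ∘ lax R (G A ⊗ X) Y ∘ (lproj adj A X ▷ R Y).
Proof.
  unfold lproj. nf. rewrite <- rw_comp. rw (lax_assoc (lax_laws R) (G A) X Y).
  rw (nat_l _). rw (interchange _ (lax R X Y)). reflexivity.
Qed.

Lemma rproj_lax X Y A :
  lax R X (Y ⊗ G A) ∘ (R X ◁ rproj adj Y A) ∘ α (R X) (R Y) A
  = fmap R (α X Y (G A)) ∘ rproj adj (X ⊗ Y) A ∘ (lax R X Y ▷ A).
Proof.
  unfold rproj. nf. rwl (interchange (lax R X Y) _).
  rw (lax_assoc (lax_laws R) X Y (G A)). rw (nat_r _).
  rw (lw_comp _ (lax R Y (G A)) _). reflexivity.
Qed.

(** With A in the middle, its unit can be absorbed by the left factor as [rproj] or by the right one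
    as [lproj]. This lets A pass from Y to X when it is braided past a tensor product. *)
Lemma rproj_lproj_lax X A Y :
  lax R (X ⊗ G A) Y ∘ (rproj adj X A ▷ R Y) ∘ (α (R X) A (R Y))⁻¹
  = fmap R (α X (G A) Y)⁻¹ ∘ lax R X (G A ⊗ Y) ∘ (R X ◁ lproj adj A Y).
Proof.
  unfold rproj, lproj. rewrite <- rw_comp, <- lw_comp. nf.
  rw (inv_nat_m _). rw (lax_assoc_inv R X (G A) Y). reflexivity.
Qed.

(** This is [lproj_lax] with second factor [G B], precomposed with the unit at B. *)
Lemma lproj_rproj A X B :
  lproj adj A (X ⊗ G B) ∘ (A ◁ rproj adj X B) ∘ α A (R X) B
  = fmap R (α (G A) X (G B)) ∘ rproj adj (G A ⊗ X) B ∘ (lproj adj A X ▷ B).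
Proof.
  unfold rproj at 1. rewrite <- lw_comp. nf. rwl (nat_r _).
  rw (lproj_lax A X (G B)). unfold rproj. nf. rw (interchange (lproj adj A X) _).
  reflexivity.
Qed.

(** Monoidality splits the unit at A ⊗ B into the units at A and B, and associativity of [lax R]
    regroups the product into two successive projections. The factor [lax G A B] remains because G
    enters only through its lax structure. *)
Lemma lproj_tens A B X :
  lproj adj (A ⊗ B) X
  = fmap R (lax G A B ▷ X) ∘ fmap R (α (G A) (G B) X)⁻¹
    ∘ lproj adj A (G B ⊗ X) ∘ (A ◁ lproj adj B X) ∘ α A B (R X).
Proof.
  unfold lproj. rewrite unit_tens, <- !rw_comp, <- lw_comp. nf.
  rw (lax_natl R _ _). rw (interchange (adj_unit adj A) (lax R (G B) X)).
  rwl (lax_assoc_inv R (G A) (G B) X).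
  rw (eq_sym (nat_m (adj_unit adj B))).
  rw (eq_sym (nat_l (adj_unit adj A))). can.
  rewrite (tensm_lr (adj_unit adj A)), <- rw_comp. reflexivity.
Qed.

Lemma rproj_tens X A B :
  rproj adj X (A ⊗ B) ∘ α (R X) A B
  = fmap R (X ◁ lax G A B) ∘ fmap R (α X (G A) (G B))
    ∘ rproj adj (X ⊗ G A) B ∘ (rproj adj X A ▷ B).
Proof.
  unfold rproj. rewrite unit_tens, <- !rw_comp, <- !lw_comp. nf.
  rw (lax_natr R _ _). rwl (interchange (lax R X (G A)) _).
  rw (lax_assoc (lax_laws R) X (G A) (G B)).
  rwl (assoc_nat (idm (R X)) (adj_unit adj A) (adj_unit adj B)).
  rewrite (tensm_lr (R X ◁ adj_unit adj A)), interchange. reflexivity.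
Qed.

Lemma lproj_unit X :
  lproj adj 𝟙 X = fmap R (lax0 G ▷ X) ∘ fmap R (λ X)⁻¹ ∘ λ (R X).
Proof.
  unfold lproj. rewrite unit_unit, <- rw_comp. rw (lax_natl R _ _).
  rewrite lax_lunit_inv. reflexivity.
Qed.

Lemma rproj_unit X :
  rproj adj X 𝟙 = fmap R (X ◁ lax0 G) ∘ fmap R (ρ X)⁻¹ ∘ ρ (R X).
Proof.
  unfold rproj. rewrite unit_unit, <- lw_comp. rw (lax_natr R _ _).
  rewrite lax_runit_inv. reflexivity.
Qed.

(** Unitality of [lax R] removes [lax0 R], so only the unit of the adjunction survives. Together
    with [rproj_lax0] this gives the centrality of [lax0 R]. *)
Lemma lproj_lax0 A :
  lproj adj A 𝟙 ∘ (A ◁ lax0 R) = fmap R (ρ (G A))⁻¹ ∘ adj_unit adj A ∘ ρ A.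
Proof.
  unfold lproj. nf. rw (interchange _ (lax0 R)). rw (lax_runit_inv R (G A)).
  rewrite runit_nat. reflexivity.
Qed.

Lemma rproj_lax0 A :
  rproj adj 𝟙 A ∘ (lax0 R ▷ A) = fmap R (λ (G A))⁻¹ ∘ adj_unit adj A ∘ λ A.
Proof.
  unfold rproj. nf. rwl (interchange (lax0 R) _). rw (lax_lunit_inv R (G A)).
  rewrite lunit_nat. reflexivity.
Qed.

(** Naturality of [lax R] moves the counit next to the unit, where a triangle identity cancels
    them. *)
Lemma lproj_counit X Y :
  fmap R (adj_counit adj X ▷ Y) ∘ lproj adj (R X) Y = lax R X Y.
Proof.
  unfold lproj. rwl (lax_natl R Y (adj_counit adj X)).
  rewrite rw_comp, adj_triangle_r, tensm_id. apply comp_id_r.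
Qed.

Lemma rproj_counit X Y :
  fmap R (X ◁ adj_counit adj Y) ∘ rproj adj X (R Y) = lax R X Y.
Proof.
  unfold rproj. rwl (lax_natr R X (adj_counit adj Y)).
  rewrite lw_comp, adj_triangle_r, tensm_id. apply comp_id_r.
Qed.
End Projections.

(** * The induced half-braiding and its compatibility with R *)

Section InducedBraiding.
Variables (C D : monoidal_category) (G : lax_functor C D) (R : lax_functor D C).
Variables (adj : monoidal_adjunction G R) (pf : projection_formula adj).
Implicit Types (A B : C) (X Y : center_ob D).

Definition lproj_iso A (X : D) : iso (A ⊗ R X) (R (G A ⊗ X)) :=
  Iso (lproj_is_iso pf A X).

Lemma lproj_induced X A :
  lproj adj A (cob X) ∘ induced_hbr pf X A
  = fmap R (hbr X (G A)) ∘ rproj adj (cob X) A.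
Proof. exact (iso_rz (lproj_iso A (cob X)) _). Qed.

Lemma induced_hbr_laws X : is_half_braiding (induced_hbr pf X).
Proof.
  split.
  - intros A B f. apply (iso_monic (lproj_iso B (cob X))). cbn [fwd lproj_iso].
    rw (lproj_induced X B). rw (rproj_natr adj (cob X) f).
    rw (lproj_natl adj (cob X) f). rw (lproj_induced X A).
    rw (lax_fmap_comp R (hbr X (G B)) _). rewrite hb_nat', <- lax_fmap_comp.
    nf. reflexivity.
  (* Cancelling the outer associator exposes the half-braiding at A ⊗ B, to which [lproj] can then
     be applied. *)
  - intros A B. apply (iso_monic (iso_inv (α A B (R (cob X))))).
    apply (iso_monic (lproj_iso (A ⊗ B) (cob X))). cbn [fwd lproj_iso iso_inv].
    rewrite iso_lz. rw (lproj_induced X (A ⊗ B)).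
    rw (rproj_tens adj (cob X) A B). rw (lproj_tens adj A B (cob X)). can.
    rw (lw_comp _ (lproj adj B (cob X)) _). rewrite lproj_induced, <- lw_comp. nf.
    rw (lproj_natr adj A (hbr X (G B))). rw (lproj_rproj adj A (cob X) B).
    rw (rw_comp _ (lproj adj A (cob X)) _). rewrite lproj_induced, <- rw_comp. nf.
    rw (rproj_natl adj B (hbr X (G A))).
    rewrite !lax_fmap_compz. nf.
    (* Naturality of c carries [lax G A B] across, leaving the tensor axiom of c at [G A] and
       [G B]. *)
    rw (hb_nat' X (lax G A B)). rewrite hb_tens_r. reflexivity.
  - apply (iso_monic (iso_inv (λ (R (cob X))))).
    apply (iso_monic (lproj_iso 𝟙 (cob X))). cbn [fwd lproj_iso iso_inv].
    rewrite iso_lz, lproj_induced, rproj_unit, lproj_unit. can.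
    rewrite !lax_fmap_compz. nf.
    (* Likewise [lax0 G] slides through c, replacing c at [G 𝟙] by c at the unit object. *)
    rw (hb_nat' X (lax0 G)).
    assert (E : hbr X 𝟙 ∘ (ρ (cob X))⁻¹ = (λ (cob X))⁻¹).
    { apply (iso_monic (λ (cob X))). rw (hb_unit' X). can. reflexivity. }
    rewrite E. reflexivity.
Qed.

Lemma induced_fmap_central X Y (f : center_hom X Y) :
  is_central (X := CenterOb (induced_hbr_laws X))
             (Y := CenterOb (induced_hbr_laws Y)) (fmap R (chom f)).
Proof.
  intros A. cbn [hbr cob].
  apply (iso_monic (lproj_iso A (cob Y))). cbn [fwd lproj_iso].
  rw (lproj_induced Y A). rw (rproj_natl adj A (chom f)).
  rw (lproj_natr adj A (chom f)). rw (lproj_induced X A).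
  rewrite !lax_fmap_compz, (chom_central f). reflexivity.
Qed.

(** After composing with [lproj], A is moved past X and Y one at a time; the three mixed
    associativity laws of [lax R] turn these moves into the image under R of the half-braiding of
    the tensor product at [G A]. *)
Lemma induced_lax_central X Y :
  is_central
    (X := center_tens (CenterOb (induced_hbr_laws X))
                      (CenterOb (induced_hbr_laws Y)))
    (Y := CenterOb (induced_hbr_laws (center_tens X Y)))
    (lax R (cob X) (cob Y)).
Proof.
  intros A. cbn [hbr cob center_tens]. rewrite tens_hbrE.
  apply (iso_monic (lproj_iso A (cob X ⊗ cob Y))). cbn [fwd lproj_iso].
  rw (lproj_induced (center_tens X Y) A).
  cbn [hbr cob center_tens]. rewrite tens_hbrE.
  rw (lproj_lax adj A (cob X) (cob Y)).
  rw (rw_comp _ (lproj adj A (cob X)) _). rewrite lproj_induced, <- rw_comp. nf.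
  rw (lax_natl R (cob Y) (hbr X (G A))).
  rw (rproj_lproj_lax adj (cob X) A (cob Y)).
  rw (lw_comp _ (lproj adj A (cob Y)) _). rewrite lproj_induced, <- lw_comp. nf.
  rw (lax_natr R (cob X) (hbr Y (G A))).
  rw (rproj_lax adj (cob X) (cob Y) A).
  rewrite !lax_fmap_compz. nf. reflexivity.
Qed.

Lemma induced_lax0_central :
  is_central (X := center_unit C)
             (Y := CenterOb (induced_hbr_laws (center_unit D))) (lax0 R).
Proof.
  intros A. cbn [hbr cob center_unit]. rewrite unit_hbrE.
  apply (iso_monic (lproj_iso A 𝟙)). cbn [fwd lproj_iso].
  rw (lproj_induced (center_unit D) A).
  cbn [hbr cob center_unit]. rewrite unit_hbrE.
  rw (lproj_lax0 adj A). rw (rproj_lax0 adj A).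
  rewrite !lax_fmap_compz. can. reflexivity.
Qed.

(** Take A = R Y: the left [lax R] is an [lproj] followed by the counit at Y, the right one an
    [rproj] followed by the same counit, and naturality of c along that counit matches them. *)
Lemma induced_lax_braided X Y :
  lax R (cob Y) (cob X) ∘ induced_hbr pf X (R (cob Y))
  = fmap R (hbr X (cob Y)) ∘ lax R (cob X) (cob Y).
Proof.
  rewrite <- (lproj_counit adj (cob Y) (cob X)).
  rewrite <- (rproj_counit adj (cob X) (cob Y)). nf.
  rw (lproj_induced X (R (cob Y))).
  rewrite !lax_fmap_compz, hb_nat'. reflexivity.
Qed.
End InducedBraiding.

Theorem theorem2 (C D : monoidal_category)
    (G : lax_functor C D) (R : lax_functor D C)
    (adj : monoidal_adjunction G R) (pf : projection_formula adj) :
  exists (hc : forall X : center D, is_half_braiding (induced_hbr pf X)),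
  let ZR (X : center D) : center C := CenterOb (hc X) in
  exists
    (hmap : forall (X Y : center D) (f : X ~> Y),
        @is_central C (ZR X) (ZR Y) (fmap R (chom f)))
    (hlax : forall X Y : center D,
        @is_central C (ZR X ⊗ ZR Y) (ZR (X ⊗ Y)) (lax R (cob X) (cob Y)))
    (hlax0 : @is_central C (𝟙 : center C) (ZR (𝟙 : center D)) (lax0 R)),
  let ZR_lax : lax_functor_data (center D) (center C) := {|
    lax_fun := {|
      fob := ZR;
      fmap := fun X Y f => @CenterHom C (ZR X) (ZR Y) (fmap R (chom f)) (hmap X Y f)
    |};
    lax := fun X Y => @CenterHom C (ZR X ⊗ ZR Y) (ZR (X ⊗ Y)) (lax R (cob X) (cob Y)) (hlax X Y);
    lax0 := @CenterHom C (𝟙 : center C) (ZR (𝟙 : center D)) (lax0 R) hlax0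
  |} in
  is_lax_functor ZR_lax /\ is_braided ZR_lax.
Proof.
  exists (induced_hbr_laws pf). cbn zeta.
  exists (@induced_fmap_central _ _ _ _ _ pf), (induced_lax_central pf),
    (induced_lax0_central pf).
  split.
  (* Equality in the center is equality of underlying morphisms, so each lax functor law is the
     corresponding law of R. *)
  - split.
    + split.
      * intros X. apply center_hom_eq, (lax_fmap_id R).
      * intros X Y Z g f. apply center_hom_eq. symmetry. apply (lax_fmap_comp R).
    + intros. apply center_hom_eq, (lax_nat (lax_laws R)).
    + intros. apply center_hom_eq, (lax_assoc (lax_laws R)).
    + intros. apply center_hom_eq, (lax_lunit (lax_laws R)).
    + intros. apply center_hom_eq, (lax_runit (lax_laws R)).
  - intros X Y. apply center_hom_eq, (induced_lax_braided pf).
Qed.
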